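(* Let $K$ be a field and $S=K[x_1,\ldots,x_n]$. If $I\subset S$ is a monomial ideal of forest type, then Stanley's conjecture holds for $S/I$; that is, there exists a Stanley decomposition $$S/I=\bigoplus_{i=1}^r u_iK[Z_i]$$ such that $|Z_i|\ge \operatorname{depth}(S/I)$ for all $i\in\{1,\ldots,r\}$.
   Context: For a monomial ideal $I$, $G(I)$ denotes its unique minimal set of monomial generators. Let $A$ be a nonempty finite set of monomials. An element $u\in A$ is called a leaf of $A$ if $u$ is the only element of $A$, or there exists $v\in A$, $v\ne u$, such that $\gcd(u,w)\mid\gcd(u,v)$ for all $w\in A$ with $w\neq u$. A monomial ideal $I$ is of forest type if every nonempty subset of $G(I)$ has a leaf. A Stanley decomposition of $S/I$ is a decomposition of $S/I$ as a finite direct sum of $K$-vector spaces of the form $uK[Z]$, where $u\in S$ is a monomial, $Z\subset\{x_1,\ldots,x_n\}$, and $uK[Z]$ denotes the subspace of $S/I$ with $K$-basis the residue classes of all monomials $uw$ with $w$ a monomial in $K[Z]$ (none of these $uw$ lying in $I$). *)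

(* Defs.v *)
From Stdlib Require Import ClassicalEpsilon.
From mathcomp Require Import all_boot all_order all_algebra.
From mathcomp Require Import finmap.
From mathcomp.multinomials Require Import mpoly.

Set Implicit Arguments.
Unset Strict Implicit.
Unset Printing Implicit Defensive.

Import GRing.Theory.
Local Open Scope ring_scope.
Local Open Scope fset_scope.

Section Monomials.

Variable n : nat.
Implicit Types (A : {fset 'X_{1..n}}) (u v w : 'X_{1..n}).

Definition mgcd u v : 'X_{1..n} := [multinom minn (u i) (v i) | i < n].

(* On exponent vectors, divisibility of monomials is [(_ <= _)%MM]. *)
Definition is_leaf A u : Prop :=
  u \in A /\
  (A = [fset u] \/
   exists2 v, v \in A & v <> u /\
     forall w, w \in A -> w <> u -> (mgcd u w <= mgcd u v)%MM).

Definition is_forest A : Prop :=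
  forall B : {fset 'X_{1..n}}, B `<=` A -> B <> fset0 -> exists u, is_leaf B u.

End Monomials.

Section Ideals.

Variables (n : nat) (K : fieldType).
Local Notation S := {mpoly K[n]}.

(* Ideals are [Prop]-valued sets: [idealr] of ring_quotient only covers
   decidable proper ideals, whereas the unit ideal is allowed here. *)
Implicit Types (I J : S -> Prop) (f g : S).

Definition ideal_gen (X : S -> Prop) f : Prop :=
  exists2 s : seq (S * S),
    (forall p, p \in s -> X p.2) & f = \sum_(p <- s) p.1 * p.2.

Definition generated_by_monomials I (M : 'X_{1..n} -> Prop) : Prop :=
  forall f, I f <-> ideal_gen (fun g => exists2 m, M m & g = 'X_[m]) f.

Definition monomial_ideal I : Prop := exists M, generated_by_monomials I M.

(* G = G(I). *)
Definition minimal_monomial_generators I (G : {fset 'X_{1..n}}) : Prop :=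
  generated_by_monomials I (fun m => m \in G) /\
  forall G' : {fset 'X_{1..n}},
    generated_by_monomials I (fun m => m \in G') -> G' `<=` G -> G' = G.

(* The set G(I) exists and is unique for every monomial ideal I, so the
   existential quantifier merely names it. *)
Definition forest_type I : Prop :=
  exists2 G, minimal_monomial_generators I G & is_forest G.

Definition irrelevant_ideal : S -> Prop :=
  ideal_gen (fun f => exists i : 'I_n, f = 'X_i).

(* The ideal I + (s). *)
Definition ideal_add I (s : seq S) : S -> Prop :=
  ideal_gen (fun f => I f \/ f \in s).

(* s is a regular sequence on S/I: each s_i is a nonzerodivisor on
   S/(I + (s_0, ..., s_(i-1))), and S/(I + (s)) is nonzero. *)
Definition regular_sequence I (s : seq S) : Prop :=
  (forall i, (i < size s)%N -> forall f,
     ideal_add I (take i s) (s`_i * f) -> ideal_add I (take i s) f) /\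
  ~ ideal_add I s 1.

Definition has_regular_sequence I (d : nat) : Prop :=
  exists s : seq S, [/\ size s = d,
    (forall f, f \in s -> irrelevant_ideal f) & regular_sequence I s].

(* depth (S/I): the largest length of a regular sequence on S/I contained in
   (x_1, ..., x_n). The value is unspecified if no largest length exists,
   which only happens when S/I = 0. *)
Definition depth I : nat :=
  epsilon (inhabits 0%N) (fun d =>
    has_regular_sequence I d /\
    forall e, has_regular_sequence I e -> (e <= d)%N).

(* g lies in K[Z]. *)
Definition in_subring (Z : {set 'I_n}) g : Prop :=
  forall m, m \in msupp g -> forall i, i \notin Z -> m i = 0%N.

(* S/I is the direct sum of the subspaces u_i K[Z_i], everything being written
   on representatives in S, modulo I:
   - the residue classes of the monomials u_i w, w in K[Z_i], are linearly
     independent in S/I (in particular none of these u_i w lies in I);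
   - the subspaces u_i K[Z_i] span S/I;
   - their sum is direct. *)
Definition stanley_decomposition I (r : nat)
    (u : 'I_r -> 'X_{1..n}) (Z : 'I_r -> {set 'I_n}) : Prop :=
  [/\ forall i g, in_subring (Z i) g -> I ('X_[u i] * g) -> g = 0,
      forall f, exists2 g : 'I_r -> S,
        (forall i, in_subring (Z i) (g i)) &
        I (f - \sum_(i < r) 'X_[u i] * g i)
    & forall g : 'I_r -> S, (forall i, in_subring (Z i) (g i)) ->
        I (\sum_(i < r) 'X_[u i] * g i) -> forall i, I ('X_[u i] * g i)].

End Ideals.

(* Main.v *)
(* If u is a leaf of G(I) then, for some variable x_i dividing u, every other
   generator has a smaller x_i-exponent. With w = u / x_i, the monomials outside
   I are those outside I + (w) together with w times those outside I : w. Both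
   ideals arise from I by coordinatewise monotone maps on the generators, hence
   are again of forest type. Induction yields a decomposition in which, for each
   Z, some monomial p outside I satisfies x_j p in I for all j outside Z.

   Such a p forces every I-regular sequence s in (x_1, ..., x_n) to have length
   at most #|Z|: otherwise some nonzero polynomial in s lies in the ideal of the
   x_j, j outside Z, hence kills p. By a form of quasi-regularity of s, p then
   lies in I + (s)^N for all N, so in I, because s has no constant terms. *)

From Stdlib Require Import ClassicalEpsilon.
Require Import Defs.
From mathcomp Require Import all_boot all_order all_algebra.
From mathcomp Require Import finmap.
From mathcomp.multinomials Require Import mpoly.
From mathcomp Require Import ring.

Set Implicit Arguments.
Unset Strict Implicit.
Unset Printing Implicit Defensive.

Import GRing.Theory.
Local Open Scope ring_scope.

(** * Quasi-regularity: cancellation in the (s)-adic filtration *)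

Section QuasiRegular.

Variable R : comNzRingType.
Implicit Types (I J : R -> Prop) (s : seq R) (x f g h w : R).

Definition is_ideal J : Prop :=
  [/\ J 0, forall a b, J a -> J b -> J (a + b) & forall r a, J a -> J (r * a)].

Lemma ideal0 J : is_ideal J -> J 0. Proof. by case. Qed.
Lemma idealD J a b : is_ideal J -> J a -> J b -> J (a + b).
Proof. by case=> _ + _; apply. Qed.
Lemma idealM J r a : is_ideal J -> J a -> J (r * a).
Proof. by case=> _ _; apply. Qed.
Lemma idealB J a b : is_ideal J -> J a -> J b -> J (a - b).
Proof. by move=> Jid Ja Jb; apply: idealD => //; rewrite -mulN1r; apply: idealM. Qed.

Lemma is_idealT : is_ideal (fun=> True). Proof. by []. Qed.

Definition addx J x f : Prop := exists a b, J a /\ f = a + x * b.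

Lemma addx_ideal J x : is_ideal J -> is_ideal (addx J x).
Proof.
move=> Jid; split.
- by exists 0, 0; split; [exact: ideal0 | ring].
- move=> _ _ [a [b [Ja ->]]] [c [d [Jc ->]]]; exists (a + c), (b + d).
  by split; [exact: idealD | ring].
- move=> r _ [a [b [Ja ->]]]; exists (r * a), (r * b).
  by split; [exact: idealM | ring].
Qed.

(* [idpow J s N] is the ideal J (s)^N. *)
Fixpoint idpow J s : nat -> R -> Prop :=
  match s with
  | [::] => fun N f => if N is 0 then J f else f = 0
  | x :: s' => fix idpow_x N f := match N with
      | 0 => J f
      | N'.+1 => exists p q, [/\ idpow_x N' p, idpow J s' N q & f = x * p + q]
      end
  end.

Lemma idpow_0 J s f : idpow J s 0 f = J f.
Proof. by case: s. Qed.

Lemma idpow_ideal J s N : is_ideal J -> is_ideal (idpow J s N).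
Proof.
move=> Jid; elim: s N => [|x s IHs] N.
  case: N => [//|N] /=; split=> // [a b -> ->|r a ->]; ring.
elim: N => [//|N IHN]; split.
- exists 0, 0; split; [exact: ideal0 | exact: ideal0 | ring].
- move=> _ _ [a [b [Ja Jb ->]]] [c [d [Jc Jd ->]]]; exists (a + c), (b + d).
  by split; [exact: (idealD IHN) | exact: idealD | ring].
- move=> r _ [a [b [Ja Jb ->]]]; exists (r * a), (r * b).
  by split; [exact: (idealM _ IHN) | exact: idealM | ring].
Qed.

Lemma idpow_in J s N f : is_ideal J -> idpow J s N f -> J f.
Proof.
move=> Jid; elim: s N f => [|x s IHs] N f.
  by case: N => [//|N] /= ->; apply: ideal0.
elim: N f => [//|N IHN] f [p [q [Ip Iq ->]]].
by apply: idealD => //; [apply: idealM => //; apply: IHN | exact: IHs Iq].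
Qed.

Lemma idpow_cons J x s N f :
  is_ideal J -> idpow J s N f -> idpow J (x :: s) N f.
Proof.
move=> Jid; case: N => [|N] Jf; first by rewrite idpow_0 in Jf.
exists 0, f; split=> //; last by ring.
exact: (ideal0 (idpow_ideal (x :: s) N Jid)).
Qed.

Lemma idpow_pred J s N f : is_ideal J -> idpow J s N.+1 f -> idpow J s N f.
Proof.
move=> Jid; elim: s N f => [|x s IHs] N f.
  by case: N => [|//] /= ->; apply: ideal0.
elim: N f => [|N IHN] f; first exact: idpow_in.
move=> [p [q [Ip Iq ->]]]; exists p, q; split=> //; first exact: IHN.
exact: IHs.
Qed.

Lemma idpow_le J s N M f :
  is_ideal J -> (N <= M)%N -> idpow J s M f -> idpow J s N f.
Proof.
move=> Jid /subnK <-; elim: (M - N)%N => [//|k IHk] /= Jf.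
by apply: IHk; apply: idpow_pred.
Qed.

Lemma idpow_mulx J x s N f :
  is_ideal J -> idpow J (x :: s) N f -> idpow J (x :: s) N.+1 (x * f).
Proof.
move=> Jid Jf; exists f, 0; split=> //; last by ring.
exact: (ideal0 (idpow_ideal s N.+1 Jid)).
Qed.

(** Expands the product (J + (x)) (s)^N, so that what an induction on s yields modulo x can be
    brought back to J. *)
Lemma idpow_addx J x s N f : is_ideal J -> idpow (addx J x) s N f ->
  exists a b, [/\ idpow J s N a, idpow (fun=> True) s N b & f = a + x * b].
Proof.
move=> Jid; elim: s N f => [|y s IHs] N f.
  case: N => [[a [b [Ja ->]]]|N /= ->]; first by exists a, b.
  by exists 0, 0; split=> //; ring.
elim: N f => [f [a [b [Ja ->]]]|N IHN f]; first by exists a, b.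
move=> [p [q [/IHN [a [b [Ja Tb ->]]] /IHs [c [d [Jc Td ->]]] ->]]].
exists (y * a + c), (y * b + d); split; last by ring.
  by exists a, c.
by exists b, d.
Qed.

Lemma idpow_cons_inv s x N f : idpow (fun=> True) (x :: s) N f ->
  exists p q, idpow (fun=> True) s N q /\ f = x * p + q.
Proof.
case: N => [_|N [p [q [_ Tq ->]]]]; last by exists p, q.
by exists 0, f; rewrite idpow_0; split=> //; ring.
Qed.

Fixpoint regular J s : Prop :=
  if s is x :: s' then
    (forall f, J (x * f) -> J f) /\ regular (addx J x) s'
  else True.

(* Modulo J, the syzygies of the degree N monomials in s are of Koszul type.
   Koszul syzygies already hold before reduction, so J (s)^N is all that is
   left of J in (s)^N. *)
Lemma regular_idpow_cap J s N f : is_ideal J -> regular J s ->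
  J f -> idpow (fun=> True) s N f -> idpow J s N f.
Proof.
elim: s J N f => [|x s IHs] J N f Jid; first by case: N.
move=> [regx regs]; have Jxid := addx_ideal x Jid.
elim: N f => [//|N IHN] f Jf [p [q [Tp Tq def_f]]].
(* Modulo J + (x) the term q vanishes, so the induction on s writes it as a + x b with a in J
   (s)^(N+1) and b in (s)^(N+1). Absorbing b into p leaves x (p + b) in J, and the induction on N
   applies to p + b. *)
have Jq : addx J x q by exists f, (- p); split=> //; rewrite def_f; ring.
have [a [b [Ja Tb def_q]]] := idpow_addx Jid (IHs _ _ _ Jxid regs Jq Tq).
exists (p + b), a; split=> //; last by rewrite def_f def_q; ring.
apply: IHN.
  apply: regx; have -> : x * (p + b) = f - a by rewrite def_f def_q; ring.
  by apply: idealB => //; apply: idpow_in Ja.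
apply: (idealD (idpow_ideal (x :: s) N is_idealT)) => //.
by apply: idpow_pred => //; apply: idpow_cons.
Qed.

Definition addpow J s N f : Prop :=
  exists a b, [/\ J a, idpow (fun=> True) s N b & f = a + b].

Lemma addpow_ideal J s N : is_ideal J -> is_ideal (addpow J s N).
Proof.
move=> Jid; have Tid := idpow_ideal s N is_idealT; split.
- by exists 0, 0; split; [exact: ideal0 | exact: ideal0 | ring].
- move=> _ _ [a [b [Ja Tb ->]]] [c [d [Jc Td ->]]]; exists (a + c), (b + d).
  by split; [exact: idealD | exact: idealD | ring].
- move=> r _ [a [b [Ja Tb ->]]]; exists (r * a), (r * b).
  by split; [exact: idealM | exact: idealM | ring].
Qed.

Lemma addpow_l J s N f : is_ideal J -> J f -> addpow J s N f.
Proof.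
move=> Jid Jf; exists f, 0; split=> //; last by ring.
exact: (ideal0 (idpow_ideal s N is_idealT)).
Qed.

Lemma addpow_r J s N f :
  is_ideal J -> idpow (fun=> True) s N f -> addpow J s N f.
Proof. by move=> Jid Tf; exists 0, f; split=> //; [exact: ideal0 | ring]. Qed.

Lemma addpow_le J s N M f : (N <= M)%N -> addpow J s M f -> addpow J s N f.
Proof.
by move=> le_NM [a [b [Ja Tb ->]]]; exists a, b; split=> //; apply: idpow_le Tb.
Qed.

(** The initial form of x is a nonzerodivisor on the graded ring of R/J along (x, s). In x w = j + x
    p + q, the term q lies in J + (x) and in (s)^(N+1), hence is a + x b with a in J and b in
    (s)^(N+1). Cancelling x puts w - p - b in J. *)
Lemma addpow_strip J x s N w : is_ideal J -> regular J (x :: s) ->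
  addpow J (x :: s) N.+1 (x * w) -> addpow J (x :: s) N w.
Proof.
move=> Jid [regx regs] [j [f [Jj [p [q [Tp Tq ->]]] def_xw]]].
have Jxid := addx_ideal x Jid.
have Jq : addx J x q.
  exists (- j), (w - p); split.
    by rewrite -sub0r; apply: idealB => //; apply: ideal0.
  by ring: def_xw.
have [a [b [Ja Tb def_q]]] := idpow_addx Jid (regular_idpow_cap Jxid regs Jq Tq).
exists (w - p - b), (p + b); split; last by ring.
  apply: regx; have -> : x * (w - p - b) = j + a by ring: def_xw def_q.
  by apply: idealD => //; apply: idpow_in Ja.
apply: (idealD (idpow_ideal (x :: s) N is_idealT)) => //.
by apply: idpow_pred => //; apply: idpow_cons.
Qed.

Lemma addpow_stripX J x s a N w : is_ideal J -> regular J (x :: s) ->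
  addpow J (x :: s) (a + N) (x ^+ a * w) -> addpow J (x :: s) N w.
Proof.
move=> Jid regxs; elim: a => [|a IHa]; first by rewrite expr0 mul1r.
by rewrite exprS -mulrA addSn => /(addpow_strip Jid regxs).
Qed.

(* The values at s of the nonzero polynomials, as far as they matter here:
   nonzero coefficients are units, and what follows the lowest power of the
   first variable may be arbitrary. *)
Fixpoint nonzero_value s g : Prop :=
  if s is x :: s' then
    exists a h r, nonzero_value s' h /\ g = x ^+ a * (h + x * r)
  else exists c, c * g = 1.

(** After the power of x is stripped, g becomes h modulo x. Induction on s cancels h and gives w =
    j' + x p + q with q deep in the filtration; g times p is then controlled one level lower, and
    induction on N cancels g from it. *)
Lemma nonzero_value_cancel J s g : is_ideal J -> regular J s ->
  nonzero_value s g ->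
  forall N, exists M, forall w, addpow J s M (g * w) -> addpow J s N w.
Proof.
elim: s J g => [|x s IHs] J g Jid.
  move=> _ [c cg1] N; exists N => w gw; rewrite -[w]mul1r -cg1 -mulrA.
  by apply: idealM => //; apply: addpow_ideal.
move=> regxs [a [h [r [nz_h ->]]]]; case: (regxs) => _ regs.
have Jxid := addx_ideal x Jid.
pose g' := h + x * r.
suff claim N : exists M, forall w,
    addpow J (x :: s) M (g' * w) -> addpow J (x :: s) N w.
  move=> N; have [M MP] := claim N; exists (a + M)%N => w.
  by rewrite -mulrA => /(addpow_stripX Jid regxs)/MP.
elim: N => [|N [M1 IHN]].
  by exists 0 => w _; apply: addpow_r => //; rewrite idpow_0.
have [M2 M2P] := IHs _ h Jxid regs nz_h (maxn N.+1 M1.+1).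
(* [M2] lets the induction on s reduce w modulo x. [M1.+1] is what remains to be stripped of one x
   in order to reach the bound [M1] for p. *)
exists (maxn M2 M1.+1) => w Hw.
have PM1id := addpow_ideal (x :: s) M1.+1 Jid.
have [j [q [[j' [p [Jj' ->]]] Tq def_w]]] : addpow (addx J x) s (maxn N.+1 M1.+1) w.
  apply: M2P; have [j [b [Jj /idpow_cons_inv [p [q [Tq ->]]] def_w]]] :=
    addpow_le (leq_maxl _ _) Hw.
  exists (j + x * (p - r * w)), q; split=> //.
    by exists j, (p - r * w).
  have -> : h * w = g' * w - x * r * w by rewrite /g'; ring.
  by rewrite def_w; ring.
have Tq' L : (L <= maxn N.+1 M1.+1)%N -> idpow (fun=> True) (x :: s) L q.
  by move=> leL; apply: idpow_cons => //; apply: idpow_le Tq.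
have /IHN[a' [b [Ja' Tb def_p]]] : addpow J (x :: s) M1 (g' * p).
  apply: addpow_strip => //.
  have -> : x * (g' * p) = g' * w - g' * j' - g' * q by rewrite def_w; ring.
  apply: idealB => //; [apply: idealB => // |]; last 2 first.
  - by apply: addpow_l => //; apply: idealM.
  - by apply: idealM => //; apply: addpow_r => //; apply: Tq'; apply: leq_maxr.
  by apply: addpow_le Hw; apply: leq_maxr.
exists (j' + x * a'), (x * b + q); split.
- by apply: idealD => //; apply: idealM.
- apply: (idealD (idpow_ideal (x :: s) N.+1 is_idealT)).
    exact: idpow_mulx.
  by apply: Tq'; apply: leq_maxl.
- by rewrite def_w def_p; ring.
Qed.

End QuasiRegular.

(** * Regular sequences in the polynomial ring *)

Section RegularSequences.

Variables (n : nat) (K : fieldType).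
Local Notation S := {mpoly K[n]}.
Implicit Types (I J X : S -> Prop) (f g : S) (s : seq S) (m u : 'X_{1..n}).

Lemma ideal_gen_ideal X : is_ideal (ideal_gen X).
Proof.
split.
- by exists [::]; rewrite ?big_nil.
- move=> _ _ [s Xs ->] [t Xt ->]; exists (s ++ t); last by rewrite big_cat.
  by move=> p; rewrite mem_cat => /orP [/Xs|/Xt].
- move=> r _ [s Xs ->]; exists [seq (r * p.1, p.2) | p <- s].
    by move=> _ /mapP [p /Xs Xp ->].
  by rewrite big_map mulr_sumr; apply: eq_bigr => p _; rewrite mulrA.
Qed.

Lemma ideal_gen_in X f : X f -> ideal_gen X f.
Proof.
by move=> Xf; exists [:: (1, f)]; rewrite ?big_seq1 ?mul1r // => p /[!inE] /eqP ->.
Qed.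

Lemma ideal_gen_min X J f :
  is_ideal J -> (forall g, X g -> J g) -> ideal_gen X f -> J f.
Proof.
move=> Jid XJ [s Xs ->]; rewrite big_seq; elim/big_ind: _ => [|a b|p /Xs/XJ].
- exact: ideal0.
- exact: idealD.
- exact: idealM.
Qed.

Lemma ideal_sum J (T : Type) (r : seq T) (P : pred T) (F : T -> S) :
  is_ideal J -> (forall i, P i -> J (F i)) -> J (\sum_(i <- r | P i) F i).
Proof.
by move=> Jid JF; elim/big_ind: _ => // [|a b]; [exact: ideal0 | exact: idealD].
Qed.

Lemma ideal_add_nil I f : is_ideal I -> ideal_add I [::] f <-> I f.
Proof.
by move=> Iid; split=> [|If]; [apply: ideal_gen_min => // g [] |
  apply: ideal_gen_in; left].
Qed.

Lemma ideal_add_cons I g s f : is_ideal I ->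
  ideal_add I (g :: s) f <-> ideal_add (addx I g) s f.
Proof.
move=> Iid; split; apply: ideal_gen_min => [|h]; try exact: ideal_gen_ideal.
- case=> [Ih|/[!inE]/orP [/eqP ->|hs]]; apply: ideal_gen_in; [left | left | by right].
    by exists h, 0; split=> //; rewrite mulr0 addr0.
  by exists 0, 1; split; [exact: ideal0 | rewrite mulr1 add0r].
- have genid := ideal_gen_ideal (fun f => I f \/ f \in g :: s).
  case=> [[a [b [Ia ->]]]|hs]; last by apply: ideal_gen_in; right; rewrite inE hs orbT.
  apply: (idealD genid); first by apply: ideal_gen_in; left.
  by rewrite mulrC; apply: (idealM _ genid); apply: ideal_gen_in; right; rewrite mem_head.
Qed.

Lemma regular_sequence_regular I s :
  is_ideal I -> regular_sequence I s -> regular I s.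
Proof.
move=> Iid [+ _]; elim: s I Iid => [//|g s IHs] I Iid regs; split.
  move=> f Igf; apply/(ideal_add_nil f Iid); apply: (regs 0) => //.
  by rewrite take0; apply/ideal_add_nil.
apply: IHs => [|i lt_i f]; first exact: addx_ideal.
by move/(ideal_add_cons _ _ _ Iid)/(regs i.+1 lt_i)/(ideal_add_cons _ _ _ Iid).
Qed.

(** Membership in the N-th power of (x_1, ..., x_n), read off the coefficients. *)
Definition vanishes_below N f := forall m, (mdeg m < N)%N -> f@_m = 0.

Lemma vanishes_belowM N f g :
  f@_0 = 0 -> vanishes_below N g -> vanishes_below N.+1 (f * g).
Proof.
move=> f0 g_v m ltmN; rewrite mcoeffM big1 // => -[k1 k2] /= /eqP def_m.
have [->|nz_k1] := eqVneq (k1 : 'X_{1..n}) 0%MM; first by rewrite f0 mul0r.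
rewrite g_v ?mulr0 //; rewrite def_m mdegD in ltmN.
by move: nz_k1 ltmN; rewrite -mdeg_eq0; case: (mdeg k1) => // k _; rewrite addSn ltnS;
  apply: leq_ltn_trans; apply: leq_addl.
Qed.

Lemma vanishes_belowD N f g :
  vanishes_below N f -> vanishes_below N g -> vanishes_below N (f + g).
Proof. by move=> f_v g_v m ltmN; rewrite mcoeffD f_v // g_v // addr0. Qed.

Lemma irrelevant_coeff0 f : irrelevant_ideal f -> f@_0 = 0.
Proof.
apply: (@ideal_gen_min _ (fun g => g@_0 = 0)); last first.
  move=> _ [i ->]; rewrite mcoeffX.
  by case: eqP => // /(congr1 (@mdeg n)); rewrite mdeg1 mdeg0.
split=> [|a b a0 b0|r a a0]; first by rewrite mcoeff0.
- by rewrite mcoeffD a0 b0 addr0.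
- by rewrite rmorphM /= a0 mulr0.
Qed.

Lemma idpow_vanishes s N f : (forall g, g \in s -> g@_0 = 0) ->
  idpow (fun=> True) s N f -> vanishes_below N f.
Proof.
elim: s N f => [|g s IHs] N f s0.
  by case: N => [|N] //= -> m _; rewrite mcoeff0.
elim: N f => [//|N IHN] f [p [q [/IHN p_v q_in ->]]].
apply: vanishes_belowD; first by apply: vanishes_belowM; rewrite ?s0 ?mem_head.
by apply: IHs q_in => h hs; rewrite s0 // inE hs orbT.
Qed.

(** * Polynomial relations by counting monomials, and the length bound *)

(** Exponent vectors are nested pairs, so that evaluation at s recurses along s just as
    [nonzero_value] does. *)
Fixpoint expo (b d : nat) : finType :=
  if d is d'.+1 then ('I_b * expo b d')%type else unit.

Lemma card_expo b d : #|expo b d| = (b ^ d)%N.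
Proof.
elim: d => [|d IHd]; first by rewrite card_unit.
by rewrite /= card_prod card_ord IHd expnS.
Qed.

Fixpoint monomial_at b s : expo b (size s) -> S :=
  match s return expo b (size s) -> S with
  | [::] => fun=> 1
  | g :: s' => fun a => g ^+ a.1 * monomial_at a.2
  end.

Lemma nonzero_value_eval b s (c : expo b (size s) -> K) :
  (exists a, c a != 0) -> nonzero_value s (\sum_a c a *: monomial_at a).
Proof.
elim: s c => [|g s IHs] /= c.
  move=> [[] nz_c]; exists (c tt)^-1%:MP.
  by rewrite (big_pred1 tt) => [|[]//]; rewrite alg_mpolyC -mpolyCM mulVf.
move=> [[i0 a0] nz_c].
pose P i := [exists a, c (i, a) != 0].
have Pi0 : P i0 by apply/existsP; exists a0.
(* The least exponent of g with a nonzero coefficient becomes the power split off in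
   [nonzero_value]; terms of larger exponent contain one more factor g and form the arbitrary
   remainder. *)
have [i /existsP Pi min_i] := arg_minnP (fun i : 'I_b => i : nat) Pi0.
pose h := \sum_a c (i, a) *: monomial_at a.
exists i, h, (\sum_(j : 'I_b | (i < j)%N) \sum_a
  c (j, a) *: (g ^+ (j - i).-1 * monomial_at a)); split; first exact: IHs.
rewrite mulrDr.
transitivity (\sum_(j < b) \sum_a c (j, a) *: (g ^+ j * monomial_at a)).
  by rewrite pair_bigA; apply: eq_bigr => -[].
rewrite (bigD1 i) //=; congr (_ + _).
  by rewrite /h mulr_sumr; apply: eq_bigr => a _; rewrite scalerAr.
rewrite mulrA -exprSr mulr_sumr (bigID (fun j : 'I_b => (i < j)%N)) /=.
rewrite [X in _ + X]big1 ?addr0 => [|j].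
  apply: eq_big => [j|j /andP [_ ltij]].
    by apply: andb_idl => lt_ij; apply: contraTneq lt_ij => ->; rewrite ltnn.
  rewrite mulr_sumr; apply: eq_bigr => a _; rewrite -scalerAr mulrA -exprD.
  by rewrite addSnnS prednK ?subn_gt0 // subnKC // ltnW.
move=> /andP [ne_ji]; rewrite -leqNgt => le_ji; apply: big1 => a _.
apply/eqP; rewrite scaler_eq0; apply/orP; left; apply: contraNT ne_ji => nz.
rewrite -val_eqE eqn_leq le_ji /=; apply: min_i; apply/existsP; by exists a.
Qed.

Definition exps_le k f := forall m, m \in msupp f -> forall j, (m j <= k)%N.

Lemma exps_leM k l f g : exps_le k f -> exps_le l g -> exps_le (k + l) (f * g).
Proof.
move=> fk gl m /msuppM_le /allpairsP [[m1 m2] /= [m1f m2g ->]] j.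
by rewrite mnmDE leq_add ?fk ?gl.
Qed.

Lemma exps_le1 : exps_le 0 1.
Proof. by move=> m; rewrite -mpolyC1 msupp1 inE => /eqP -> j; rewrite mnm0E. Qed.

Lemma exps_leX k f i : exps_le k f -> exps_le (i * k) (f ^+ i).
Proof.
by move=> fk; elim: i => [|i IHi]; [exact: exps_le1 | rewrite exprS; exact: exps_leM].
Qed.

Lemma monomial_at_exps_le b k s (a : expo b (size s)) :
  (forall f, f \in s -> exps_le k f) ->
  exps_le (size s * (b * k)) (monomial_at a).
Proof.
elim: s a => [|g s IHs] /= a sk; first exact: exps_le1.
apply: exps_leM => [m gm j|]; last first.
  by apply: IHs => f fs; apply: sk; rewrite inE fs orbT.
have /(_ m gm j) := exps_leX (i := a.1) (sk g (mem_head _ _)).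
by move/leq_trans; apply; rewrite leq_mul2r ltnW ?orbT.
Qed.

Lemma row_kernel_neq0 p q (A : 'M[K]_(p, q)) :
  (q < p)%N -> exists2 v : 'rV_p, v != 0 & v *m A = 0.
Proof.
move=> lt_qp; have /rowV0Pn [v /sub_kermxP vA0 nz_v] : kermx A != 0.
  by rewrite kermx_eq0 -row_leq_rank -ltnNge (leq_ltn_trans _ lt_qp) ?rank_leq_col.
by exists v.
Qed.

(* With exponents below b there are b^(size s) monomials in s, but only
   O(b^#|Z|) monomials of K[Z] can occur in them. *)
Lemma dependent_mod_variables s (Z : {set 'I_n}) : (#|Z| < size s)%N ->
  exists2 g, nonzero_value s g &
    forall m, m \in msupp g -> exists2 j, j \notin Z & m j != 0%N.
Proof.
move=> lt_Zs; set d := size s.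
pose D := \max_(f <- s) msize f.
have sD f : f \in s -> exps_le D f.
  move=> fs m fm j; apply: (@leq_trans (mdeg m)).
    by rewrite mdegE (bigD1 j) //= leq_addr.
  by apply: leq_trans (ltnW (msize_mdeg_lt fm)) _; apply: leq_bigmax_seq.
(* With this b, (b (d D + 1))^#|Z| = b^#|Z| (b - 1) < b^(#|Z| + 1) <= b^d, while C + 1 <= b (d D +
   1). *)
pose b := ((d * D).+1 ^ #|Z|).+1.
pose C := (d * (b * D))%N.
pose P := [pred e | e \in pffun_on (ord0 : 'I_C.+1) Z predT].
have lt_PT : (#|P| < #|expo b d|)%N.
  rewrite card_expo.
  rewrite (_ : #|P| = #|pffun_on (ord0 : 'I_C.+1) Z predT|); last exact: eq_card.
  rewrite card_pffun_on card_ord.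
  have leC : (C.+1 <= b * (d * D).+1)%N by rewrite /C mulnS mulnCA -add1n leq_add.
  apply: leq_ltn_trans (_ : (b * (d * D).+1) ^ #|Z| < _)%N.
    by case: #|Z| => // k; rewrite leq_exp2r.
  rewrite expnMn; apply: (@leq_trans (b ^ #|Z|.+1)); last by rewrite leq_pexp2l.
  by rewrite expnSr ltn_pmul2l ?expn_gt0.
pose mon (e : {ffun 'I_n -> 'I_C.+1}) := [multinom (e j : nat) | j < n].
(* Each row lists the coefficients of one monomial in s at the monomials of K[Z] with exponents at
   most C. A linear relation between rows is a combination with no term in K[Z], since larger
   exponents never occur. *)
pose A := \matrix_(i < #|expo b d|, k < #|P|)
  (@monomial_at b s (enum_val i))@_(mon (enum_val k)).
have [v nz_v vA0] := row_kernel_neq0 A lt_PT.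
exists (\sum_a v 0 (enum_rank a) *: @monomial_at b s a).
  apply: nonzero_value_eval; have /rV0Pn [i nz_vi] := nz_v.
  by exists (enum_val i); rewrite enum_valK.
move=> m gm; apply/exists_inP; apply: contraLR gm.
rewrite negb_exists_in => /forall_inP mZ.
rewrite mcoeff_msupp negbK raddf_sum /=.
have [mC|] := boolP [forall j, m j <= C]%N; last first.
  rewrite negb_forall => /existsP [j ltCm]; apply/eqP/big1 => a _.
  rewrite mcoeffZ memN_msupp_eq0 ?mulr0 //; apply: contra ltCm => am.
  exact: (monomial_at_exps_le sD am).
pose e := [ffun j => inord (m j) : 'I_C.+1].
have eP : e \in P.
  apply/pffun_onP; split=> //; apply/subsetP => j; rewrite !inE ffunE.
  by apply: contraNT => /mZ /negPn/eqP ->; apply/eqP/val_inj; rewrite /= inordK.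
have := congr1 (fun w : 'rV_ _ => w 0 (enum_rank_in eP e)) vA0.
rewrite !mxE => def0; apply/eqP; rewrite -[RHS]def0.
rewrite [RHS](reindex enum_rank) /=; last by apply: onW_bij; apply: enum_rank_bij.
apply: eq_bigr => a _; rewrite mxE mcoeffZ enum_rankK enum_rankK_in //.
congr (_ * mcoeff _ _); apply/mnmP => j; rewrite mnmE ffunE inordK // ltnS.
exact: (forallP mC).
Qed.

Lemma regular_size_le I s (Z : {set 'I_n}) u : is_ideal I ->
  (forall f m, I f -> m \in msupp f -> I 'X_[m]) ->
  ~ I 'X_[u] -> (forall j, j \notin Z -> I 'X_[u + U_(j)]) ->
  (forall f, f \in s -> f@_0 = 0) -> regular I s -> (size s <= #|Z|)%N.
Proof.
move=> Iid Imon nIu IuZ s0 regs; case: leqP => // /dependent_mod_variables.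
case=> g nz_g gZ; case: nIu.
(* Above the degree of u, the (s)-adic part has no coefficient at u, so u must occur in the part
   lying in I. *)
have [M MP] := nonzero_value_cancel Iid regs nz_g (mdeg u).+1.
have /MP [a [b [Ia b_in def_u]]] : addpow I s M (g * 'X_[u]).
  apply: addpow_l => //; rewrite [g]mpolyE mulr_suml big_seq.
  apply: ideal_sum => // m /gZ [j jZ mj].
  have le_jm : (U_(j) <= m)%MM by rewrite lep1mP.
  rewrite -scalerAl -mpolyXD -(submK le_jm) -addmA [(U_(j) + u)%MM]addmC.
  by rewrite mpolyXD -mul_mpolyC; do 2 apply: idealM => //; apply: IuZ.
apply: (Imon a) => //; rewrite mcoeff_msupp.
have := congr1 (mcoeff u) def_u.
by rewrite mcoeffD (idpow_vanishes s0 b_in) // addr0 mcoeffX eqxx => <-; apply: oner_neq0.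
Qed.

End RegularSequences.

(** * Forests of monomials and their leaves *)

Section Forests.

Variable n : nat.
Implicit Types (G : seq 'X_{1..n}) (m p u v w g : 'X_{1..n}) (Y Z : {set 'I_n}).

(** Sequences allow repetitions and redundant generators, which arise when a map identifies
    monomials or makes one divide another. *)
Definition forest_seq G : Prop :=
  forall B : {fset 'X_{1..n}}, {subset B <= G} -> B <> fset0 ->
    exists u, is_leaf B u.

Definition map_mnm (F : 'I_n -> nat -> nat) m := [multinom F j (m j) | j < n].

(** Coordinatewise monotone maps commute with gcd and preserve divisibility, so a leaf of a set of
    chosen preimages maps to a leaf. *)
Lemma forest_map F G : (forall j, {homo F j : a b / (a <= b)%N}) ->
  forest_seq G -> forest_seq (map (map_mnm F) G).
Proof.
move=> Fmono Gforest B sBG nzB.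
(* A section of the map over B. It is injective there, so distinct elements of B keep distinct
   preimages. *)
pose psi b := epsilon (inhabits b) (fun a => a \in G /\ map_mnm F a = b).
have psiP b : b \in B -> psi b \in G /\ map_mnm F (psi b) = b.
  move=> /sBG /mapP [a aG def_b].
  by apply: (epsilon_spec _ (fun a => a \in G /\ map_mnm F a = b)); exists a.
have F_gcd a b : map_mnm F (mgcd a b) = mgcd (map_mnm F a) (map_mnm F b).
  apply/mnmP => j; rewrite !mnmE.
  case/orP: (leq_total (a j) (b j)) => le_j; have := Fmono j _ _ le_j => leF.
    by rewrite !(minn_idPl _).
  by rewrite !(minn_idPr _).
have F_le a b : (a <= b)%MM -> (map_mnm F a <= map_mnm F b)%MM.
  by move=> /mnm_lepP le_ab; apply/mnm_lepP => j; rewrite !mnmE; apply: Fmono.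
have [||_ [/imfsetP [u /= uB ->] leaf_u]] := Gforest [fset psi b | b in B]%fset.
- by move=> _ /imfsetP [b /= /psiP [? _] ->].
- move=> B0; apply: nzB; apply/fsetP => b; rewrite in_fset0; apply/negbTE/negP => bB.
  by have := in_imfset imfset_key psi bB; rewrite /= B0 in_fset0.
exists u; split=> //; case: leaf_u => [B1|[_ /imfsetP [v /= vB ->] [ne_vu leaf_v]]].
  left; apply/fsetP => b; rewrite in_fset1; apply/idP/eqP => [bB|->//].
  have := in_imfset imfset_key psi bB; rewrite /= B1 in_fset1 => /eqP eq_psi.
  by have [_ <-] := psiP _ bB; have [_ <-] := psiP _ uB; rewrite eq_psi.
right; exists v => //; split=> [eq_vu|w wB ne_wu]; first by rewrite eq_vu in ne_vu.
have [_ def_u] := psiP _ uB; have [_ def_v] := psiP _ vB.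
have [_ def_w] := psiP _ wB.
rewrite -def_u -def_v -def_w -!F_gcd; apply: F_le; apply: leaf_v.
  exact: (in_imfset imfset_key psi wB).
by move=> eq_psi; apply: ne_wu; rewrite -def_w eq_psi.
Qed.

Lemma forest_filter (P : pred 'X_{1..n}) G : forest_seq G -> forest_seq (filter P G).
Proof.
move=> Gforest B sBG; apply: Gforest => b /sBG; by rewrite mem_filter => /andP [].
Qed.

(** If a leaf u with partner v does not divide v, pick i with v_i < u_i. For every other w, min(u_i,
    w_i) <= v_i < u_i forces w_i < u_i. The first two alternatives cover unit and redundant
    generators. *)
Lemma forest_leaf G : forest_seq G -> G != [::] -> exists2 u, u \in G &
  [\/ u = 0%MM, exists2 v, v \in G & v != u /\ (u <= v)%MM |
      exists2 i, (0 < u i)%N & forall w, w \in G -> w != u -> (w i < u i)%N].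
Proof.
move=> Gforest nzG; have [||u [+ leaf_u]] := Gforest [fset x in G]%fset.
- by move=> b; rewrite inE.
- case: G nzG {Gforest} => // g G _ /fsetP /(_ g).
  by rewrite !inE eqxx.
rewrite inE => uG; exists u => //.
case: leaf_u => [G1|[v]]; last rewrite inE => vG [/eqP ne_vu leaf_v].
  have [->|nz_u] := eqVneq u 0%MM; first by constructor 1.
  constructor 3; have : ~~ [forall i, u i == 0%N].
    apply: contraNN nz_u => /forallP u0; apply/eqP/mnmP => i.
    by rewrite mnm0E; apply/eqP.
  rewrite negb_forall => /existsP [i nz_ui]; exists i; first by rewrite lt0n.
  move=> w wG ne_wu; have : w \in [fset x in G]%fset by rewrite inE.
  by rewrite G1 in_fset1 (negbTE ne_wu).
have [le_uv|] := boolP (u <= v)%MM; first by constructor 2; exists v.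
rewrite negb_forall => /existsP [i]; rewrite -ltnNge => lt_vu.
constructor 3; exists i; first exact: leq_ltn_trans lt_vu.
move=> w wG /eqP ne_wu; have /mnm_lepP/(_ i) : (mgcd u w <= mgcd u v)%MM.
  by apply: leaf_v; rewrite ?inE.
rewrite !mnmE (minn_idPr (ltnW lt_vu)) geq_min leqNgt lt_vu /=.
by move/leq_ltn_trans; apply.
Qed.

(** * Partitions of the monomials outside (G) into boxes *)

Definition in_mideal G p := has (fun g => (g <= p)%MM) G.

Definition supported Y p := [forall j, (j \notin Y) ==> (p j == 0%N)].

Definition in_box p (b : 'X_{1..n} * {set 'I_n}) :=
  (b.1 <= p)%MM && supported b.2 (p - b.1)%MM.

(* The colon ideal (G) : p in K[Y] is proper and contains the variables of Y
   outside Z, so the depth is at most #|Z|. *)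
Definition depth_face Y G Z := exists p, [/\ supported Y p, ~~ in_mideal G p &
  forall j, j \in Y -> j \notin Z -> in_mideal G (p + U_(j))%MM].

(** A Stanley decomposition of K[Y]/((G) meet K[Y]) on monomials: a count of 0 or 1 says at once
    that the boxes avoid (G), are disjoint and cover. *)
Definition box_partition Y G bs : Prop :=
  (forall p, count (in_box p) bs = (supported Y p && ~~ in_mideal G p)) /\
  (forall b, b \in bs -> depth_face Y G b.2).

Lemma supportedP Y p :
  reflect (forall j, j \notin Y -> p j = 0%N) (supported Y p).
Proof.
apply: (iffP forallP) => [pY j jY|pY j]; last by apply/implyP => /pY ->.
by apply/eqP; apply: (implyP (pY j)).
Qed.

Lemma supportedD Y p m : supported Y (p + m)%MM = supported Y p && supported Y m.
Proof.
apply/supportedP/andP => [pmY|[/supportedP pY /supportedP mY] j jY]; last first.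
  by rewrite mnmDE pY ?mY.
by split; apply/supportedP => j /pmY /eqP; rewrite mnmDE addn_eq0 => /andP [/eqP ? /eqP ?].
Qed.

Lemma supported1 Y j : supported Y U_(j)%MM = (j \in Y).
Proof.
apply/supportedP/idP => [jY|jY i iY].
  by apply/negPn/negP => /jY; rewrite mnm1E eqxx.
by rewrite mnm1E; case: eqP => // eq_ji; rewrite -eq_ji jY in iY.
Qed.

Lemma supported_le Y p m : (m <= p)%MM -> supported Y p -> supported Y m.
Proof. by move=> /submK <-; rewrite supportedD => /andP []. Qed.

Lemma box_partition_eq Y G G' bs :
  (forall p, supported Y p -> in_mideal G' p = in_mideal G p) ->
  box_partition Y G' bs -> box_partition Y G bs.
Proof.
move=> eqG [bs_count bs_face]; split=> [p|b /bs_face [p [pY pG pj]]].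
  by rewrite bs_count; case pY: (supported Y p); rewrite // eqG.
exists p; split=> // [|j jY jZ]; first by rewrite -eqG.
by rewrite -eqG ?pj // supportedD pY supported1.
Qed.

(** The induction measure. The added 1 makes it drop when any generator is deleted, even the
    monomial 1. *)
Definition weight G := (\sum_(g <- G) (mdeg g).+1)%N.

Lemma weight_map (f : 'X_{1..n} -> 'X_{1..n}) G u : u \in G ->
  (forall g, mdeg (f g) <= mdeg g)%N -> (mdeg (f u) < mdeg u)%N ->
  (weight (map f G) < weight G)%N.
Proof.
move=> uG fle flt; rewrite /weight big_map !(big_rem u uG) /= -addSn leq_add ?ltnS //.
by apply: leq_sum => g _; rewrite ltnS.
Qed.

Lemma weight_filter G u : u \in G -> (weight (filter (predC1 u) G) < weight G)%N.
Proof.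
move=> uG; rewrite /weight big_filter (big_rem u uG) /= eqxx /=.
rewrite [ltnRHS](big_rem u uG) /= addSn ltnS.
apply: leq_trans (leq_addl _ _); rewrite [leqRHS](bigID (predC1 u)) /=.
exact: leq_addr.
Qed.

Lemma in_mideal_filter G v p :
  ((v <= p)%MM -> exists2 u, u \in G & u != v /\ (u <= p)%MM) ->
  in_mideal (filter (predC1 v) G) p = in_mideal G p.
Proof.
move=> vP; apply/hasP/hasP => -[g].
  by rewrite mem_filter => /andP [_ gG] le_gp; exists g.
have [->|ne_gv gG le_gp] := eqVneq g v; last by exists g; rewrite // mem_filter /= ne_gv.
by move=> _ /vP [u uG [ne_uv le_up]]; exists u; rewrite // mem_filter /= ne_uv.
Qed.

(* [map_mnm cap] sends u to w and fixes the other generators, so that its image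
   generates I + (w). If p witnesses a face for I + (w), then p or p x_i
   witnesses the same face for I. *)
Lemma box_partition_split Y G u i : let w := (u - U_(i))%MM in
    u \in G -> supported Y u -> (0 < u i)%N ->
    (forall g, g \in G -> g != u -> (g i < u i)%N) ->
    let cap (j : 'I_n) (a : nat) := if j == i then minn (u i).-1 a else a in
    forall bs1 bs2, box_partition Y (map (map_mnm cap) G) bs1 ->
    box_partition Y (map (fun g => g - w)%MM G) bs2 ->
    box_partition Y G (bs1 ++ [seq ((w + b.1)%MM, b.2) | b <- bs2]).
Proof.
move=> w uG uY ui_gt0 ui_max cap bs1 bs2 [count1 face1] [count2 face2].
have w_i : w i = (u i).-1 by rewrite /w mnmBE mnm1E eqxx subn1.
have w_j j : j != i -> w j = u j.
  by move=> ne_ji; rewrite /w mnmBE mnm1E eq_sym (negbTE ne_ji) subn0.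
have def_u : u = (w + U_(i))%MM by rewrite submK // lep1mP -lt0n.
have wY : supported Y w by move: uY; rewrite def_u supportedD => /andP [].
have iY : i \in Y by move: uY; rewrite def_u supportedD supported1 => /andP [].
have le_wu : (w <= u)%MM by rewrite def_u lem_addr.
have cap_u : map_mnm cap u = w.
  apply/mnmP => j; rewrite mnmE /cap; case: eqVneq => [->|/w_j ->//].
  by rewrite w_i; apply/minn_idPl/leq_pred.
have cap_g g : g \in G -> g != u -> map_mnm cap g = g.
  move=> gG ne_gu; apply/mnmP => j; rewrite mnmE /cap; case: eqVneq => // ->.
  by apply/minn_idPr; rewrite -ltnS prednK ?ui_max.
have in_cap p : in_mideal (map (map_mnm cap) G) p = in_mideal G p || (w <= p)%MM.
  rewrite /in_mideal has_map; apply/hasP/orP => [[g gG /=]|].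
    have [->|ne_gu] := eqVneq g u; first by rewrite cap_u; right.
    by rewrite cap_g // => le_gp; left; apply/hasP; exists g.
  case=> [/hasP [g gG le_gp]|le_wp]; last by exists u; rewrite //= cap_u.
  have [eq_gu|ne_gu] := eqVneq g u; last by exists g; rewrite //= cap_g.
  by exists u; rewrite //= cap_u (lepm_trans le_wu) // -eq_gu.
have in_sub p : in_mideal (map (fun g => g - w)%MM G) p = in_mideal G (p + w)%MM.
  rewrite /in_mideal has_map; apply: eq_has => g /=.
  apply/mnm_lepP/mnm_lepP => H j; have := H j.
    by rewrite mnmDE mnmBE leq_subLR addnC.
  by rewrite mnmDE mnmBE leq_subLR addnC.
have in_G p : in_mideal G p -> p i = w i -> exists2 g, g \in G & g != u /\ (g <= p)%MM.
  move=> /hasP [g gG le_gp] p_i; exists g => //; split=> //.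
  apply: contraTneq le_gp => ->; apply/negP => /mnm_lepP/(_ i).
  by rewrite p_i w_i leqNgt prednK // leqnn.
(* The boxes of [bs1] count the monomials not divisible by w; those of [bs2], shifted by w, count
   its multiples. *)
split=> [p|b].
  rewrite count_cat count1 in_cap count_map.
  have [le_wp|nle_wp] := boolP (w <= p)%MM; last first.
    rewrite orbF (eq_count (a2 := pred0)) ?count_pred0 ?addn0 // => b /=.
    by apply: contraNF nle_wp => /andP [/= + _]; apply: lepm_trans (lem_addr _ _).
  rewrite orbT andbF add0n.
  rewrite (eq_count (a2 := in_box (p - w)%MM)) => [|b].
    rewrite count2 in_sub submK //; congr (nat_of_bool (_ && _)).
    by rewrite -[in RHS](submK le_wp) supportedD wY andbT.
  rewrite /in_box /= submDA; congr (_ && _).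
  apply/mnm_lepP/mnm_lepP => H j; have := H j; rewrite mnmDE mnmBE.
    by rewrite leq_subRL // (mnm_lepP le_wp).
  by rewrite leq_subRL // (mnm_lepP le_wp).
rewrite mem_cat => /orP [/face1 [p [pY pG pj]]|]; last first.
  move=> /mapP [b2 /face2 [p [pY pG pj]] ->].
  exists (p + w)%MM; split=> /= [||j jY jZ]; first by rewrite supportedD pY.
    by rewrite -in_sub.
  by rewrite -addmA [(w + _)%MM]addmC addmA -in_sub pj.
have [pG' nle_wp] : ~~ in_mideal G p /\ ~~ (w <= p)%MM.
  by move: pG; rewrite in_cap negb_or => /andP.
(* If w_i <= p_i, then p x_i stays outside I: generators other than u gain nothing from x_i, and u =
   w x_i would force w to divide p. When w divides p x_j, u divides p x_i x_j. *)
have [le_wp|lt_pw] := leqP (w i) (p i).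
  have not_w g : g \in G -> g != u -> (g <= p + U_(i))%MM -> (g <= p)%MM.
    move=> gG ne_gu /mnm_lepP le_gp; apply/mnm_lepP => j; have := le_gp j.
    rewrite mnmDE mnm1E; case: eqVneq => [<- _|]; last by rewrite addn0.
    by apply: leq_trans le_wp; rewrite w_i -ltnS prednK // ui_max.
  exists (p + U_(i))%MM; split=> [||j jY jZ].
  - by rewrite supportedD pY supported1.
  - apply: contra pG' => /hasP [g gG le_gp]; apply/hasP.
    have [eq_gu|ne_gu] := eqVneq g u; last by exists g => //; apply: not_w.
    case/negP: nle_wp; move: le_gp; rewrite eq_gu def_u => /mnm_lepP le_gp.
    by apply/mnm_lepP => j; have := le_gp j; rewrite !mnmDE leq_add2r.
  - have := pj j jY jZ; rewrite in_cap => /orP [/hasP [g gG le_gp]|le_wpj].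
      apply/hasP; exists g => //; apply: lepm_trans le_gp _.
      by rewrite -addmA [(U_(i) + _)%MM]addmC addmA lem_addr.
    apply/hasP; exists u => //; rewrite def_u -addmA [(U_(i) + _)%MM]addmC addmA.
    by apply/mnm_lepP => k; rewrite !mnmDE leq_add2r -mnmDE; apply: (mnm_lepP le_wpj).
(* Now p_i < w_i, so p x_j with j != i is no multiple of w and lies in I itself. The witness changes
   to p x_i only if i is outside the face and p x_i is outside I; then w divides p x_i. *)
have pj' j : j \in Y -> j \notin b.2 -> j != i -> in_mideal G (p + U_(j))%MM.
  move=> jY jZ ne_ji; have := pj j jY jZ; rewrite in_cap => /orP [//|/mnm_lepP/(_ i)].
  by rewrite mnmDE mnm1E (negbTE ne_ji) addn0 leqNgt lt_pw.
have [iZ|iZ] := boolP (i \in b.2).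
  exists p; split=> // j jY jZ; apply: pj' => //.
  by apply: contraNneq jZ => ->.
have [piG|piG] := boolP (in_mideal G (p + U_(i))%MM).
  by exists p; split=> // j jY jZ; have [->//|] := eqVneq j i; apply: pj'.
have le_wpi : (w <= p + U_(i))%MM.
  by have := pj i iY iZ; rewrite in_cap (negbTE piG).
exists (p + U_(i))%MM; split=> // [|j jY jZ]; first by rewrite supportedD pY supported1.
have [->|ne_ji] := eqVneq j i.
  apply/hasP; exists u => //; rewrite def_u.
  by apply/mnm_lepP => k; rewrite !mnmDE leq_add2r -mnmDE; apply: (mnm_lepP le_wpi).
have /hasP [g gG le_gp] := pj' j jY jZ ne_ji.
apply/hasP; exists g => //; apply: lepm_trans le_gp _.
by rewrite -addmA [(U_(i) + _)%MM]addmC addmA lem_addr.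
Qed.

Lemma forest_box_partition Y G :
  forest_seq G -> exists bs, box_partition Y G bs.
Proof.
have [k] := ubnP (weight G); elim: k Y G => // k IHk Y G /[!ltnS] leGk Gforest.
have IH Y' G' : (weight G' < weight G)%N -> forest_seq G' ->
    exists bs, box_partition Y' G' bs.
  by move=> ltG; apply: IHk; apply: leq_trans leGk.
have [G0|nzG] := eqVneq G [::].
  rewrite {}G0; exists [:: (0%MM, Y)]; split=> [p|b /[!inE] /eqP ->].
    rewrite /= /in_box /= subm0 addn0 andbT; case: (0 <= p)%MM / mnm_lepP => // -[] j.
    by rewrite mnm0E.
  exists 0%MM; split=> // [|j jY]; last by rewrite jY.
  by apply/supportedP => j _; rewrite mnm0E.
have [u uG] := forest_leaf Gforest nzG.
case=> [u0|[v vG [ne_vu le_uv]]|[i ui_gt0 ui_max]].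
- exists [::]; split=> // p /=.
  suff -> : in_mideal G p by rewrite andbF.
  by apply/hasP; exists u; rewrite // u0; apply/mnm_lepP => j; rewrite mnm0E.
- have [bs bsP] := IH Y _ (weight_filter vG) (forest_filter Gforest).
  exists bs; apply: box_partition_eq bsP => p _; apply: in_mideal_filter => le_vp.
  by exists u; rewrite // eq_sym ne_vu (lepm_trans le_uv).
have IHu Y' := IH Y' _ (weight_filter uG) (forest_filter Gforest).
have [uY|uY] := boolP (supported Y u); last first.
  have [bs bsP] := IHu Y; exists bs; apply: box_partition_eq bsP => p pY.
  apply: in_mideal_filter => le_up; case/negP: uY; exact: supported_le pY.
have iY : i \in Y.
  by apply: contraLR ui_gt0 => iY; rewrite (supportedP _ _ uY).
(* For u = x_i one has w = 1, and the colon by w would be no progress. Removing i from Y kills x_i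
   instead and drops u from the generators. *)
have [u1|ne_u1] := eqVneq u U_(i)%MM.
  have [bs [bs_count bs_face]] := IHu (Y :\ i).
  have G_eq p : in_mideal G p = (p i != 0%N) || in_mideal (filter (predC1 u) G) p.
    have [pi0|nz_pi] := eqVneq (p i) 0%N; last first.
      by apply/hasP; exists u; rewrite // u1 lep1mP.
    by rewrite in_mideal_filter // u1 lep1mP pi0.
  have Y_eq p : supported (Y :\ i) p = supported Y p && (p i == 0%N).
    apply/supportedP/andP => [pY|[/supportedP pY /eqP pi0] j].
      split; last by rewrite pY // !inE eqxx.
      by apply/supportedP => j jY; rewrite pY // !inE negb_and jY orbT.
    by rewrite !inE negb_and negbK => /orP [/eqP ->|/pY].
  exists bs; split=> [p|b /bs_face [p [pY pG pj]]].
    by rewrite bs_count Y_eq G_eq negb_or negbK andbA.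
  move: pY; rewrite Y_eq => /andP [pY pi0]; exists p; split=> // [|j jY jZ].
    by rewrite G_eq pi0.
  rewrite G_eq; have [eq_ji|ne_ji] := eqVneq j i.
    by rewrite eq_ji mnmDE mnm1E eqxx addn1.
  by rewrite pj ?orbT // !inE ne_ji.
set cap := fun (j : 'I_n) (a : nat) => if j == i then minn (u i).-1 a else a.
set w := (u - U_(i))%MM.
have def_u : u = (w + U_(i))%MM by rewrite submK // lep1mP -lt0n.
have nz_w : w != 0%MM by apply: contraNneq ne_u1 => w0; rewrite def_u w0 add0m.
have [bs1 bs1P] : exists bs, box_partition Y (map (map_mnm cap) G) bs.
  apply: IH; last first.
    apply: forest_map => // j a b le_ab; rewrite /cap; case: eqP => // _.
    by rewrite leq_min geq_minl geq_min le_ab orbT.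
  apply: (weight_map uG) => [g|].
    by rewrite !mdegE leq_sum // => j _; rewrite mnmE /cap; case: ifP; rewrite ?geq_minr.
  rewrite !mdegE (bigD1 i) //= [ltnRHS](bigD1 i) //= -addSn leq_add //.
    by rewrite mnmE /cap eqxx (minn_idPl (leq_pred _)) prednK.
  by rewrite leq_sum // => j _; rewrite mnmE /cap; case: ifP; rewrite ?geq_minr.
have sub_cap g : (g - w)%MM = map_mnm (fun j a => (a - w j)%N) g.
  by apply/mnmP => j; rewrite mnmBE mnmE.
have [bs2 bs2P] : exists bs, box_partition Y (map (fun g => g - w)%MM G) bs.
  apply: IH; last first.
    rewrite (eq_map sub_cap); apply: forest_map => // j a b le_ab.
    exact: leq_sub2r.
  apply: (weight_map uG) => [g|]; first exact: mdegB.
  rewrite [in X in (X < _)%N]def_u addmC addmK mdeg1 def_u mdegD mdeg1 addn1 ltnS lt0n.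
  by rewrite mdeg_eq0.
by eexists; apply: (box_partition_split uG uY ui_gt0 ui_max bs1P bs2P).
Qed.

End Forests.

(** * From box partitions to Stanley decompositions and depth *)

Section StanleyDecomposition.

Variables (n : nat) (K : fieldType) (I : {mpoly K[n]} -> Prop).
Variable G : seq 'X_{1..n}.
Local Notation S := {mpoly K[n]}.

Definition supported_ideal (f : S) := forall m, m \in msupp f -> in_mideal G m.

Lemma in_mideal_le p m : (p <= m)%MM -> in_mideal G p -> in_mideal G m.
Proof.
by move=> le_pm /hasP [g gG le_gp]; apply/hasP; exists g => //; apply: lepm_trans le_pm.
Qed.

Lemma supported_ideal_ideal : is_ideal supported_ideal.
Proof.
split=> [m|a b aG bG m|r a aG m]; first by rewrite msupp0.
  by move=> /msuppD_le; rewrite mem_cat => /orP [/aG|/bG].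
move=> /msuppM_le /allpairsP [[m1 m2] /= [_ /aG + ->]].
exact: in_mideal_le (lem_addl _ _).
Qed.

Hypothesis I_gen : generated_by_monomials I (fun m => m \in G).

Lemma monomial_idealP f : I f <-> supported_ideal f.
Proof.
split=> [If|fG].
  have [fX _] := I_gen f.
  apply: (ideal_gen_min (J := supported_ideal) _ _ (fX If)) => [|_ [m mG ->] p].
    exact: supported_ideal_ideal.
  by rewrite msuppX inE => /eqP ->; apply/hasP; exists m; rewrite // lepm_refl.
apply/I_gen; have genid := ideal_gen_ideal (fun g : S => exists2 m, m \in G & g = 'X_[m]).
rewrite [f]mpolyE big_seq; apply: ideal_sum => // m /fG /hasP [g gG le_gm].
rewrite -mul_mpolyC -(submK le_gm) mpolyXD; do 2 apply: (idealM _ genid).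
by apply: ideal_gen_in; exists g.
Qed.

Lemma monomial_ideal_ideal : is_ideal I.
Proof.
have [h1 h2 h3] := supported_ideal_ideal.
split=> [|a b|r a]; rewrite !monomial_idealP; [exact: h1 | exact: h2 | exact: h3].
Qed.

Lemma monomial_idealX m : I 'X_[m] <-> in_mideal G m.
Proof.
rewrite monomial_idealP /supported_ideal msuppX.
by split=> [|? p /[!inE] /eqP -> //]; apply; rewrite mem_head.
Qed.

Lemma mcoeff_XM (u m : 'X_{1..n}) (g : S) :
  ('X_[u] * g)@_m = if (u <= m)%MM then g@_(m - u) else 0.
Proof.
rewrite mulrC; case: ifP => [le_um|nle_um].
  by rewrite -{1}(submK le_um) addmC mcoeffMX.
apply: memN_msupp_eq0; apply/negP => /msuppM_le /allpairsP [[m1 m2] /=].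
by rewrite msuppX inE => -[_ /eqP -> def_m]; rewrite def_m lem_addl in nle_um.
Qed.

Lemma count_in_box_nth (bs : seq ('X_{1..n} * {set 'I_n})) b0 p i j :
  (count (in_box p) bs <= 1)%N -> (i < size bs)%N -> (j < size bs)%N ->
  in_box p (nth b0 bs i) -> in_box p (nth b0 bs j) -> i = j.
Proof.
elim: bs i j => [//|b bs IHbs] [|i] [|j] //=.
- move=> le1 _ ltj pb pj; have: has (in_box p) bs.
    by apply/hasP; exists (nth b0 bs j); rewrite ?mem_nth.
  by rewrite has_count; move: le1; rewrite pb; case: (count _ _).
- move=> le1 lti _ pi pb; have: has (in_box p) bs.
    by apply/hasP; exists (nth b0 bs i); rewrite ?mem_nth.
  by rewrite has_count; move: le1; rewrite pb; case: (count _ _).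
- move=> le1 lti ltj pi pj; congr _.+1; apply: IHbs pi pj => //.
  exact: leq_trans (leq_addl _ _) le1.
Qed.

(** The classes of the monomials outside I form a K-basis of S/I, and the boxes partition this
    basis. *)
Lemma box_partition_stanley bs (b := fun i : 'I_(size bs) => tnth (in_tuple bs) i) :
  box_partition setT G bs ->
  stanley_decomposition I (fun i => (b i).1) (fun i => (b i).2).
Proof.
move=> [bs_count _].
have fullT (p : 'X_{1..n}) : supported setT p by apply/supportedP => j; rewrite inE.
have box_notin p i : in_box p (b i) -> ~~ in_mideal G p.
  move=> pb; have: has (in_box p) bs by apply/hasP; exists (b i); rewrite ?mem_tnth.
  by rewrite has_count bs_count fullT; case: (in_mideal G p).
have box_uniq p i j : in_box p (b i) -> in_box p (b j) -> i = j.
  rewrite /b !(tnth_nth (0%MM, set0)) /= => pi pj; apply/val_inj.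
  by apply: count_in_box_nth pi pj; rewrite ?ltn_ord // bs_count; case: (_ && _).
have box_ex p : ~~ in_mideal G p -> exists i, in_box p (b i).
  move=> npG; have: has (in_box p) bs by rewrite has_count bs_count fullT npG.
  by case/hasP=> c /(tnthP (in_tuple bs)) [i ->] pc; exists i.
have in_boxD i (g : S) m :
    in_subring (b i).2 g -> m \in msupp g -> in_box ((b i).1 + m)%MM (b i).
  move=> gZ mg; rewrite /in_box lem_addr addmC addmK; apply/supportedP => j jZ.
  exact: gZ mg j jZ.
split=> [i g gZ|f|g gZ /monomial_idealP sumI i].
- move=> /monomial_idealP gI; apply/eqP/negPn/negP; rewrite -msupp_eq0.
  case def_g: (msupp g) => [//|m s] _.
  have mg : m \in msupp g by rewrite def_g mem_head.
  case/negP: (box_notin _ _ (in_boxD i g m gZ mg)); apply: gI.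
  by rewrite mcoeff_msupp mcoeff_XM lem_addr addmC addmK -mcoeff_msupp.
(* The terms of f inside box i, divided by the corner of the box. The terms of f in no box are
   exactly those in I. *)
- pose g i := \sum_(m <- msupp f | in_box m (b i)) f@_m *: 'X_[m - (b i).1] : S.
  exists g => [i m mg|].
    apply/supportedP; move: mg; rewrite mcoeff_msupp; apply: contraNT => mZ.
    rewrite raddf_sum /= big1 // => p /andP [_ pZ]; rewrite mcoeffZ mcoeffX.
    by case: eqP mZ => [<-|]; rewrite ?pZ ?mulr0.
  apply/monomial_idealP => m; apply: contraLR => mG; rewrite mcoeff_msupp negbK.
  have [i mi] := box_ex m mG.
  rewrite mcoeffB raddf_sum /= (bigD1 i) //= big1 => [|j ne_ji]; last first.
    rewrite mulr_sumr raddf_sum /= big1 // => p /andP [le_bp pj].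
    rewrite -scalerAr -mpolyXD addmC submK // mcoeffZ mcoeffX.
    case: eqP => [eq_pm|]; rewrite ?mulr0 //; case/eqP: ne_ji.
    by apply: box_uniq mi; rewrite -eq_pm /in_box le_bp.
  rewrite addr0 mulr_sumr raddf_sum /= subr_eq0; apply/eqP.
  transitivity (\sum_(p <- msupp f | in_box p (b i))
    if p == m then f@_p else 0); last first.
    apply: eq_bigr => p /andP [le_bp _].
    rewrite -scalerAr -mpolyXD addmC submK // mcoeffZ mcoeffX.
    by case: eqP; rewrite ?mulr1 ?mulr0.
  rewrite -big_mkcondr /= (eq_bigl (fun p => p == m)) => [|p]; last first.
    by case: eqVneq => [->|]; rewrite ?andbF // andbT mi.
  have [mf|mf] := boolP (m \in msupp f).
    by rewrite -big_filter filter_pred1_uniq ?msupp_uniq // big_seq1.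
  rewrite (memN_msupp_eq0 mf) big_seq_cond big1 // => p /andP [pf /eqP eq_pm].
  by rewrite -eq_pm pf in mf.
(* A monomial of the i-th summand lies in box i and in no other, so it keeps its coefficient in the
   whole sum. *)
apply/monomial_idealP => m; rewrite mcoeff_msupp mcoeff_XM.
case: ifP => [le_bm nz|]; last by rewrite eqxx.
have mi : in_box m (b i).
  by rewrite -(submK le_bm) addmC; apply: in_boxD; rewrite ?mcoeff_msupp.
apply: sumI; rewrite mcoeff_msupp raddf_sum /= (bigD1 i) //= big1 => [|j ne_ji].
  by rewrite addr0 mcoeff_XM le_bm.
rewrite mcoeff_XM; case: ifP => // le_bj; apply/eqP; apply: contraNT ne_ji => nzj.
apply/eqP; apply: box_uniq mi; rewrite -(submK le_bj) addmC.
by apply: in_boxD; rewrite ?mcoeff_msupp.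
Qed.

Lemma depth_le (Z : {set 'I_n}) : depth_face setT G Z -> (depth I <= #|Z|)%N.
Proof.
move=> [p [_ pG pj]]; have Iid := monomial_ideal_ideal.
have bound e : has_regular_sequence I e -> (e <= #|Z|)%N.
  case=> s [<- s_irr s_reg]; apply: (@regular_size_le n K I s Z p) => //.
  - by move=> f m /monomial_idealP fG /fG /monomial_idealX.
  - by rewrite monomial_idealX; apply/negP.
  - by move=> j jZ; apply/monomial_idealX; rewrite pj ?inE.
  - by move=> f /s_irr; apply: irrelevant_coeff0.
  - exact: regular_sequence_regular.
have reg0 : has_regular_sequence I 0.
  exists [::]; split=> //; split=> // /(ideal_add_nil _ Iid) I1.
  by case/negP: pG; apply/monomial_idealX; rewrite -['X_[p]]mulr1; apply: idealM.
pose is_depth d := has_regular_sequence I d /\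
  forall e, has_regular_sequence I e -> (e <= d)%N.
(* [epsilon] yields the depth only once a largest length exists: 0 is a length because p is outside
   I, and all lengths are bounded by #|Z|. *)
suff dP : exists d, is_depth d.
  by apply: bound; case: (epsilon_spec (inhabits 0%N) is_depth dP).
pose P e : bool := excluded_middle_informative (has_regular_sequence I e).
have PP e : reflect (has_regular_sequence I e) (P e) by apply: sumboolP.
have P0 : exists e, P e by exists 0%N; apply/PP.
case: (ex_maxnP P0 (fun e Pe => bound e (PP e Pe))) => d /PP Id max_d.
by exists d; split=> // e /PP; apply: max_d.
Qed.

End StanleyDecomposition.

Theorem corollary3p7 (K : fieldType) (n : nat) (I : {mpoly K[n]} -> Prop)
    (hI : monomial_ideal I) (hforest : forest_type I) :
  exists (r : nat) (u : 'I_r -> 'X_{1..n}) (Z : 'I_r -> {set 'I_n}),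
    stanley_decomposition I u Z /\
    forall i : 'I_r, (depth I <= #|Z i|)%N.
Proof.
have [G [I_gen _] Gforest] := hforest.
have [|bs bsP] := @forest_box_partition n setT G.
  by move=> B sBG; apply: Gforest; apply/fsubsetP.
exists (size bs); do 2 eexists; split; first exact: box_partition_stanley bsP.
move=> i /=; apply: (depth_le I_gen); case: bsP => _; apply; exact: mem_tnth.
Qed.
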